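(* Let $K\geq1$ and $K'\geq0$, and let $f(z)=\sum_{n=0}^{\infty}a_{n}z^{n}+\sum_{n=1}^{\infty}\overline{b}_{n}\overline{z}^{n}$ be a harmonic $(K,K')$-quasiconformal mapping in $\mathbb{D}$. If $\ell_{f}^{\ast}(1)=\sup_{\theta\in[0,2\pi]}\ell_{f}^{\ast}(1,\theta)<\infty$, then for every $n\geq1$, $$|a_{n}|+|b_{n}|\leq\sqrt{K'}+K\ell_{f}^{\ast}(1).$$ In particular, if $K'=0$ and $K=1$, then this estimate is sharp, with extremal function $f(z)=\ell_{f}^{\ast}(1)z$ for $z\in\mathbb{D}$ (for which equality holds when $n=1$).
   Context: $\mathbb{D}=\{z\in\mathbb{C}:|z|<1\}$. For a complex-valued function $f$ put $f_z=(f_x-if_y)/2$, $f_{\overline z}=(f_x+if_y)/2$, $\|D_f\|=|f_z|+|f_{\overline z}|$ and $J_f=|f_z|^2-|f_{\overline z}|^2$. A sense-preserving homeomorphism $f:\Omega_1\to\Omega_2$ between subdomains of $\mathbb{C}$ is a $(K,K')$-quasiconformal mapping ($K\ge1$, $K'\ge0$) if $f$ is absolutely continuous on lines in $\Omega_1$ and $\|D_f(z)\|^2\le KJ_f(z)+K'$ for $z\in\Omega_1$. It is harmonic $(K,K')$-quasiconformal if in addition $f$ is harmonic (as a complex-valued function, $\Delta f=0$). A mapping ''in $\mathbb{D}$'' is one from $\mathbb{D}$ onto its image $f(\mathbb{D})$. For $f\in\mathcal{C}^1(\mathbb{D})$, $\theta\in[0,2\pi]$ and $0\le r<1$, the radial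 length is $$\ell_f^{\ast}(r,\theta)=\int_0^r\left|f_z(\rho e^{i\theta})+e^{-2i\theta}f_{\overline z}(\rho e^{i\theta})\right|d\rho,$$ and $\ell_f^{\ast}(1,\theta)=\sup_{0\le r<1}\ell_f^{\ast}(r,\theta)$. *)

(* Defs.v *)
From HB Require Import structures.
From mathcomp Require Import all_boot all_order all_algebra.
From mathcomp Require Import complex.
From mathcomp Require Import all_classical all_reals all_analysis.

Set Implicit Arguments.
Unset Strict Implicit.
Unset Printing Implicit Defensive.

Import Order.TTheory GRing.Theory Num.Theory.
Import numFieldNormedType.Exports.

Local Open Scope classical_set_scope.
Local Open Scope ring_scope.
Local Open Scope complex_scope.

Section PlaneMappings.
Context {R : realType}.

(* The topology of the complex plane, that of the norm, is provided by the
   library on the copy R[i]^o of R[i]. *)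
Local Notation C := (R[i]^o).

Implicit Types (f : C -> C) (z w : C) (W : set C) (r x y t : R).

(* The norm `|z| of the library is R[i]-valued; cabs is the R-valued modulus. *)
Definition cabs z : R := complex.Re `|z|.

Definition unit_disc : set C := [set z | cabs z < 1].

Definition cis t : C := cos t +i* sin t.

(* Since R[i]^o carries no normed R-module structure, real partial derivatives
   are taken componentwise. *)
Definition partial_x f z : C :=
  derive1 (fun t => complex.Re (f (t +i* complex.Im z))) (complex.Re z)
  +i* derive1 (fun t => complex.Im (f (t +i* complex.Im z))) (complex.Re z).

Definition partial_y f z : C :=
  derive1 (fun t => complex.Re (f (complex.Re z +i* t))) (complex.Im z)
  +i* derive1 (fun t => complex.Im (f (complex.Re z +i* t))) (complex.Im z).

Definition has_partials f z : Prop :=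
  [/\ derivable (fun t : R => complex.Re (f (t +i* complex.Im z)))
        (complex.Re z) 1,
      derivable (fun t : R => complex.Im (f (t +i* complex.Im z)))
        (complex.Re z) 1,
      derivable (fun t : R => complex.Re (f (complex.Re z +i* t)))
        (complex.Im z) 1 &
      derivable (fun t : R => complex.Im (f (complex.Re z +i* t)))
        (complex.Im z) 1].

Definition d_z f z : C := (partial_x f z - 'i * partial_y f z) / 2.

Definition d_zbar f z : C := (partial_x f z + 'i * partial_y f z) / 2.

Definition norm_D f z : R := cabs (d_z f z) + cabs (d_zbar f z).

Definition jacobian f z : R := cabs (d_z f z) ^+ 2 - cabs (d_zbar f z) ^+ 2.

Definition class_C1 W f : Prop :=
  [/\ forall z, W z -> has_partials f z,
      {in W, continuous (partial_x f)} &
      {in W, continuous (partial_y f)}].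

Definition class_C2 W f : Prop :=
  [/\ class_C1 W f, class_C1 W (partial_x f) & class_C1 W (partial_y f)].

Definition laplacian f z : C :=
  partial_x (partial_x f) z + partial_y (partial_y f) z.

Definition harmonic_on W f : Prop :=
  class_C2 W f /\ (forall z, W z -> laplacian f z = 0).

Definition domain W : Prop := [/\ open W, connected W & W !=set0].

Definition homeomorphism (W1 W2 : set C) f : Prop :=
  [/\ set_bij W1 W2 f,
      {within W1, continuous f} &
      exists2 g : C -> C, {within W2, continuous g} &
        forall z, W1 z -> g (f z) = z].

(* The closed curve c, parametrized by [0, 2 pi], has winding number 1 about w:
   phi is a continuous branch of arg (c - w) along c. *)
Definition winds_once (c : R -> C) w : Prop :=
  (forall t, 0 <= t <= 2 * pi -> c t != w) /\
  exists phi : R -> R,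
    [/\ {within `[0, 2 * pi], continuous phi},
        forall t, 0 <= t <= 2 * pi ->
          c t - w = (cabs (c t - w))%:C * cis (phi t) &
        phi (2 * pi) - phi 0 = 2 * pi].

(* Orientation of a plane homeomorphism: its local degree at each point is 1. *)
Definition sense_preserving W f : Prop :=
  forall w r, 0 < r -> (forall z, cabs (z - w) <= r -> W z) ->
    winds_once (fun t => f (w + r%:C * cis t)) (f w).

Definition abs_continuous (a b : R) (g : R -> C) : Prop :=
  forall e : R, 0 < e -> exists2 d : R, 0 < d &
    forall (n : nat) (s t : 'I_n -> R),
      (forall k, a <= s k /\ s k <= t k /\ t k <= b) ->
      trivIset setT (fun k => `]s k, t k[%classic) ->
      \sum_(k < n) (t k - s k) < d ->
      \sum_(k < n) cabs (g (t k) - g (s k)) < e.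

Definition ACL W f : Prop :=
  forall a b c d : R,
    (forall x y, a <= x <= b -> c <= y <= d -> W (x +i* y)) ->
    {ae (@lebesgue_measure R), forall y,
       c <= y <= d -> abs_continuous a b (fun x => f (x +i* y))} /\
    {ae (@lebesgue_measure R), forall x,
       a <= x <= b -> abs_continuous c d (fun y => f (x +i* y))}.

Definition quasiconformal (K K' : R) (W1 W2 : set C) f : Prop :=
  [/\ domain W1 /\ domain W2,
      homeomorphism W1 W2 f,
      sense_preserving W1 f,
      ACL W1 f &
      forall z, W1 z -> norm_D f z ^+ 2 <= K * jacobian f z + K'].

Definition harmonic_quasiconformal_in_disc (K K' : R) f : Prop :=
  quasiconformal K K' unit_disc (f @` unit_disc) f /\ harmonic_on unit_disc f.

Definition radial_length f (r t : R) : \bar R :=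
  (\int[lebesgue_measure]_(rho in `[0%R, r])
     (cabs (d_z f (rho%:C * cis t)
            + cis (- (2 * t)) * d_zbar f (rho%:C * cis t)))%:E)%E.

Definition radial_length1 f (t : R) : \bar R :=
  ereal_sup [set radial_length f r t | r in [set r : R | 0 <= r < 1]].

Definition sup_radial_length f : \bar R :=
  ereal_sup [set radial_length1 f t | t in [set t : R | 0 <= t <= 2 * pi]].

(* f z = \sum_(n >= 0) a_n z^n + \sum_(n >= 1) conj(b_n) conj(z)^n in the unit
   disc; the value b 0 plays no role. *)
Definition harmonic_expansion f (a b : nat -> C) : Prop :=
  forall z, unit_disc z -> exists u v : C,
    [/\ (fun N : nat => \sum_(0 <= n < N) a n * z ^+ n) @ \oo --> u,
        (fun N : nat => \sum_(1 <= n < N) (b n)^* * z^* ^+ n) @ \oo --> v &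
        f z = u + v].

End PlaneMappings.

(* Main.v *)
Require Import Defs.
From HB Require Import structures.
From mathcomp Require Import all_boot all_order all_algebra.
From mathcomp Require Import complex.
From mathcomp Require Import all_classical all_reals all_analysis.
From mathcomp Require Import measurable_realfun.
From mathcomp Require Import zify ring lra.

Set Implicit Arguments.
Unset Strict Implicit.
Unset Printing Implicit Defensive.

Import Order.TTheory GRing.Theory Num.Theory.
Import numFieldNormedType.Exports.

Local Open Scope classical_set_scope.
Local Open Scope ring_scope.
Local Open Scope complex_scope.

(** Why the bound holds.  Write f = h + conj(g) in the disc, with h = sum a_n z^n
    and g = sum b_n z^n, so that f_z = h' and f_zbar = conj(g').  The coefficient
    n a_n r^(n-1) of h' is a mean of h'(r e^(it)) e^(-i(n-1)t) over the circle of
    radius r, and likewise for g', whence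
      n (|a_n| + |b_n|) r^(n-1) <= mean over t of ||D_f(r e^(it))||.
    Solving the quadratic inequality ||D_f||^2 <= K J_f + K' gives
      ||D_f|| <= sqrt K' + K max(|f_z| - |f_zbar|, 0)
              <= sqrt K' + K |f_z + e^(-2it) f_zbar|
    ([norm_D_le]), and the last modulus is the integrand of the radial length.
    Integrating in r over [0, rho] gives
      (|a_n| + |b_n|) rho^n <= sqrt K' + K l*(1),
    and rho -> 1 concludes ([coef_bound]).

    Two devices keep the analysis elementary.  First, f_z and f_zbar are never
    identified with the sums of power series: f minus a long enough section of its
    expansion is Lipschitz with a small constant on each smaller disc
    ([harmonic_tail_lipschitz]), so f_z and f_zbar are uniformly close to the
    polynomials obtained by differentiating that section ([wirtinger_approx]).
    Second, for a polynomial of degree less than N the mean over the circle may be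
    replaced by the mean over the N-th roots of unity ([coef_le_average]); only
    integrals in r remain, and no exchange of integrals is needed
    ([integrate_radial_average]).

    For the dilation z |-> L z everything is explicit: its derivatives are constant,
    and its radial length over [0, r] is L r. *)

(** * The modulus and the topology of the plane *)

Section Modulus.
Context {R : realType}.
Local Notation C := (R[i]^o).
Implicit Types (z w : C) (x y t : R).

Lemma normC_cabs z : `|z| = (cabs z)%:C.
Proof. by rewrite /cabs normc_def. Qed.

Lemma cabsE z : cabs z = Num.sqrt (complex.Re z ^+ 2 + complex.Im z ^+ 2).
Proof. by rewrite /cabs normc_def. Qed.

Lemma cabs_ge0 z : 0 <= cabs z.
Proof. by rewrite cabsE sqrtr_ge0. Qed.

Lemma cabsM z w : cabs (z * w) = cabs z * cabs w.
Proof. by apply: complexI; rewrite rmorphM /= -!normC_cabs normrM. Qed.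

Lemma cabsD z w : cabs (z + w) <= cabs z + cabs w.
Proof. by rewrite -lecR rmorphD /= -!normC_cabs ler_normD. Qed.

Lemma cabsN z : cabs (- z) = cabs z.
Proof. by apply: complexI; rewrite -!normC_cabs normrN. Qed.

Lemma cabsB z w : cabs (z - w) <= cabs z + cabs w.
Proof. by rewrite -(cabsN w) cabsD. Qed.

Lemma cabs_distC z w : cabs (z - w) = cabs (w - z).
Proof. by rewrite -cabsN opprB. Qed.

Lemma cabs_real x : cabs x%:C = `|x|.
Proof. by rewrite cabsE /= expr0n addr0 sqrtr_sqr. Qed.

Lemma cabs0 : cabs (0 : C) = 0.
Proof. by rewrite (cabs_real 0) normr0. Qed.

Lemma cabs1 : cabs (1 : C) = 1.
Proof. by rewrite (cabs_real 1) normr1. Qed.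

Lemma cabs_i : cabs ('i : C) = 1.
Proof. by rewrite cabsE /= expr0n add0r expr1n sqrtr1. Qed.

Lemma cabs_nat n : cabs (n%:R : C) = n%:R.
Proof. by rewrite -(rmorph_nat (real_complex R)) cabs_real normr_nat. Qed.

Lemma cabsX z n : cabs (z ^+ n) = cabs z ^+ n.
Proof. by elim: n => [|n IH]; rewrite ?cabs1// !exprS cabsM IH. Qed.

Lemma cabsV z : cabs z^-1 = (cabs z)^-1.
Proof.
have [->|z0] := eqVneq z 0; first by rewrite invr0 cabs0 invr0.
by apply: complexI; rewrite fmorphV /= -!normC_cabs normfV.
Qed.

Lemma cabs_conj z : cabs (z^*) = cabs z.
Proof. by rewrite !cabsE; case: z => x y /=; rewrite sqrrN. Qed.

Lemma cabs_sum (I : Type) (r : seq I) (P : pred I) (F : I -> C) :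
  cabs (\sum_(i <- r | P i) F i) <= \sum_(i <- r | P i) cabs (F i).
Proof.
elim/big_rec2: _ => [|i y1 y2 _ le12]; first by rewrite cabs0.
by rewrite (le_trans (cabsD _ _))// lerD2l.
Qed.

Lemma cabs_le_ReIm z : cabs z <= `|complex.Re z| + `|complex.Im z|.
Proof.
rewrite [in cabs z](complexE z); apply: le_trans (cabsD _ _) _.
by rewrite cabsM cabs_i mul1r !cabs_real.
Qed.

Lemma cabs_cis t : cabs (cis t) = 1.
Proof. by rewrite cabsE /= cos2Dsin2 sqrtr1. Qed.

Lemma cabs_polar x t : 0 <= x -> cabs (x%:C * cis t) = x.
Proof. by move=> x0; rewrite cabsM cabs_cis mulr1 cabs_real ger0_norm. Qed.

Lemma cisD x y : cis (x + y) = cis x * cis y :> C.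
Proof.
apply/eqP; rewrite eq_complex /cis cosD sinD /=.
by apply/andP; split; apply/eqP => //; rewrite addrC [X in X + _]mulrC mulrC.
Qed.

Lemma cis_mulrn n t : cis (t *+ n) = cis t ^+ n :> C.
Proof.
elim: n => [|n IH]; first by rewrite /cis cos0 sin0.
by rewrite mulrS cisD IH exprS.
Qed.

Lemma complex_eta z : complex.Re z +i* complex.Im z = z.
Proof. by case: z. Qed.

(** Convergence for the topology of the plane, brought back to real radii. *)
Lemma cvg_cabsP (T : Type) (F : set_system T) {FF : Filter F} (h : T -> C) z :
  h @ F --> z <-> forall e : R, 0 < e -> \forall x \near F, cabs (z - h x) < e.
Proof.
split=> [/cvgrPdist_lt hz e e0|hz].
  have := hz e%:C; rewrite ltcR => /(_ e0); apply: filterS => x.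
  by rewrite normC_cabs ltcR.
apply/cvgrPdist_lt => e; rewrite ltcE /= => /andP[/eqP ime re].
apply: filterS (hz _ re) => x.
by rewrite normC_cabs ltcE /= ime eqxx.
Qed.

Lemma cvg_Re_Im (T : Type) (F : set_system T) {FF : Filter F} (g h : T -> R) x y :
  g @ F --> x -> h @ F --> y -> (fun s => g s +i* h s : C) @ F --> (x +i* y : C).
Proof.
move=> /cvgrPdist_lt gx /cvgrPdist_lt hy; apply/cvg_cabsP => e e0.
have e2 : 0 < e / 2 by rewrite divr_gt0.
near=> s; apply: le_lt_trans (cabs_le_ReIm _) _ => /=.
by rewrite (splitr e) ltrD//; near: s; [exact: gx|exact: hy].
Unshelve. all: by end_near. Qed.

Lemma cvg_cabs0 (T : Type) (F : set_system T) {FF : Filter F} (h : T -> C) z :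
  h @ F --> z -> (fun s => cabs (z - h s)) @ F --> (0 : R).
Proof.
move=> /cvg_cabsP hz; apply/cvgrPdist_lt => e /hz; apply: filterS => s.
by rewrite sub0r normrN ger0_norm// cabs_ge0.
Qed.

Lemma cvg_mulC (T : Type) (F : set_system T) {FF : Filter F} (g h : T -> C) z w :
  g @ F --> z -> h @ F --> w -> (fun s => g s * h s) @ F --> (z * w : C).
Proof.
move=> /cvg_cabs0 gz /cvg_cabs0 hw; apply/cvg_cabsP => e e0.
have : (fun s => cabs (z - g s) * cabs w + cabs z * cabs (w - h s) +
    cabs (z - g s) * cabs (w - h s)) @ F --> 0 * cabs w + cabs z * 0 + 0 * 0.
  by apply: cvgD; [apply: cvgD; [exact: cvgMl|exact: cvgMr]|exact: cvgM].
rewrite !(mul0r, mulr0, addr0) => /cvgr_lt/(_ _ e0); apply: filterS => s.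
apply: le_lt_trans; rewrite -!cabsM.
have -> : z * w - g s * h s =
    (z - g s) * w + z * (w - h s) - (z - g s) * (w - h s) by ring.
by apply: le_trans (cabsB _ _) _; rewrite lerD2r cabsD.
Qed.

Lemma cvg_conj (T : Type) (F : set_system T) {FF : Filter F} (h : T -> C) z :
  h @ F --> z -> (fun s => (h s)^* : C) @ F --> (z^* : C).
Proof.
move=> /cvg_cabsP hz; apply/cvg_cabsP => e /hz; apply: filterS => s.
by rewrite -cabs_conj rmorphB.
Qed.

Lemma near_cabs z (e : R) : 0 < e -> \forall w \near z, cabs (z - w) < e.
Proof.
move=> e0; apply/nbhs_ballP; exists e%:C; first by rewrite /= ltcR.
by move=> w; rewrite /ball /= normC_cabs ltcR.
Qed.

Lemma cabs_continuous : continuous (@cabs R).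
Proof.
move=> z; apply/(cvgrPdist_lt (FF := nbhs_filter z)) => e e0.
apply: (@filterS _ _ (nbhs_filter z) _ _ _ (near_cabs z e0)) => w.
apply: le_lt_trans; rewrite ler_norml; apply/andP; split.
  by rewrite lerNl opprB lerBlDr cabs_distC (le_trans _ (cabsD _ _))// subrK.
by rewrite lerBlDr (le_trans _ (cabsD _ _))// subrK.
Qed.

Lemma real_complex_continuous : continuous (fun x => x%:C : C).
Proof.
move=> x; apply: cvg_Re_Im; first exact: cvg_id.
exact: cvg_cst.
Qed.

End Modulus.

(** * Directional difference quotients *)

Section DifferenceQuotients.
Context {R : realType}.
Local Notation C := (R[i]^o).
Implicit Types (f g : C -> C) (z w v d : C) (c : nat -> C).

(** The partial derivatives in x and in y are the limits of the quotients in the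
    directions 1 and 'i; treating them as one family halves the work below. *)
Definition dir_quot f z v (t : R) : C := (f (z + t%:C * v) - f z) / t%:C.

Lemma div_real_complex w (t : R) :
  w / t%:C = (t^-1 * complex.Re w) +i* (t^-1 * complex.Im w).
Proof.
rewrite -fmorphV; case: w => x y.
apply/eqP; rewrite eq_complex /=.
by apply/andP; split; apply/eqP; ring.
Qed.

Lemma partial_x_dir_quot f z : has_partials f z ->
  dir_quot f z 1 @ 0^' --> partial_x f z.
Proof.
move=> [dx1 dx2 _ _].
rewrite /partial_x !derive1E.
rewrite [X in X @ _](_ : _ = fun t =>
  (t^-1 *: (((fun t : R => complex.Re (f (t +i* complex.Im z))) \o
     shift (complex.Re z)) (t *: 1) - complex.Re (f (complex.Re z +i* complex.Im z)))) +i*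
  (t^-1 *: (((fun t : R => complex.Im (f (t +i* complex.Im z))) \o
     shift (complex.Re z)) (t *: 1) - complex.Im (f (complex.Re z +i* complex.Im z))))).
  by apply: cvg_Re_Im; [exact: dx1|exact: dx2].
apply/funext => t; rewrite /dir_quot div_real_complex /= complex_eta.
have -> : z + t%:C * 1 = (t * 1 + complex.Re z) +i* complex.Im z.
  by apply/eqP; rewrite eq_complex; case: z {dx1 dx2} => x y /=;
    apply/andP; split; apply/eqP; ring.
by congr (_ +i* _); rewrite /GRing.scale /= raddfB.
Qed.

Lemma partial_y_dir_quot f z : has_partials f z ->
  dir_quot f z 'i @ 0^' --> partial_y f z.
Proof.
move=> [_ _ dy1 dy2].
rewrite /partial_y !derive1E.
rewrite [X in X @ _](_ : _ = fun t =>
  (t^-1 *: (((fun t : R => complex.Re (f (complex.Re z +i* t))) \o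
     shift (complex.Im z)) (t *: 1) - complex.Re (f (complex.Re z +i* complex.Im z)))) +i*
  (t^-1 *: (((fun t : R => complex.Im (f (complex.Re z +i* t))) \o
     shift (complex.Im z)) (t *: 1) - complex.Im (f (complex.Re z +i* complex.Im z))))).
  by apply: cvg_Re_Im; [exact: dy1|exact: dy2].
apply/funext => t; rewrite /dir_quot div_real_complex /= complex_eta.
have -> : z + t%:C * 'i = complex.Re z +i* (t * 1 + complex.Im z).
  by apply/eqP; rewrite eq_complex; case: z {dy1 dy2} => x y /=;
    apply/andP; split; apply/eqP; ring.
by congr (_ +i* _); rewrite /GRing.scale /= raddfB.
Qed.

(** Lipschitz estimates survive pointwise limits of functions, whereas
    derivatives need not converge; this recovers a derivative bound afterwards. *)
Lemma lipschitz_dir_quot_le g z v d (rho e : R) :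
  (forall w w', cabs w < rho -> cabs w' < rho ->
     cabs (g w - g w') <= e * cabs (w - w')) ->
  cabs z < rho -> cabs v = 1 -> dir_quot g z v @ 0^' --> d -> cabs d <= e.
Proof.
move=> lip zrho v1 gd.
have cgd : (cabs \o dir_quot g z v) @ 0^' --> cabs d.
  by apply: cvg_comp gd _; exact: cabs_continuous.
apply: (cvgr_to_le cgd); near=> t => /=.
have t0 : t != 0 by near: t; exact: nbhs_dnbhs_neq.
have tsmall : `|t| < rho - cabs z.
  near: t; apply: dnbhs0_lt; by rewrite subr_gt0.
rewrite /dir_quot cabsM cabsV cabs_real ler_pdivrMr ?normr_gt0//.
apply: le_trans (lip _ _ _ zrho) _.
  apply: le_lt_trans (cabsD _ _) _.
  by rewrite cabsM v1 mulr1 cabs_real -ltrBrDl.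
by rewrite addrAC subrr add0r cabsM v1 mulr1 cabs_real.
Unshelve. all: by end_near. Qed.

Lemma dir_quot_conj g z v d : dir_quot g z v @ 0^' --> d ->
  dir_quot (fun w => (g w)^*) z v @ 0^' --> (d^* : C).
Proof.
move=> /cvg_conj; apply: cvg_trans; apply: near_eq_cvg; apply: nearW => t.
by rewrite /dir_quot fmorph_div rmorphB [X in _ / X = _](conjc_real t).
Qed.

Lemma dir_quotD f g z v d d' :
  dir_quot f z v @ 0^' --> d -> dir_quot g z v @ 0^' --> d' ->
  dir_quot (fun w => f w + g w) z v @ 0^' --> d + d'.
Proof.
move=> fd gd; rewrite [X in X @ _](_ : _ = dir_quot f z v \+ dir_quot g z v).
  exact: cvgD fd gd.
by apply/funext => t; rewrite /dir_quot /= -mulrDl opprD addrACA.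
Qed.

Lemma dir_quotB f g z v d d' :
  dir_quot f z v @ 0^' --> d -> dir_quot g z v @ 0^' --> d' ->
  dir_quot (fun w => f w - g w) z v @ 0^' --> d - d'.
Proof.
move=> fd gd; rewrite [X in X @ _](_ : _ = dir_quot f z v \- dir_quot g z v).
  exact: cvgB fd gd.
by apply/funext => t; rewrite /dir_quot /=; ring.
Qed.

Lemma cvg_line z v : (fun t : R => z + t%:C * v) @ 0^' --> z.
Proof.
have v1 : 0 < cabs v + 1 by rewrite ltr_wpDl// cabs_ge0.
apply/cvg_cabsP => e e0; near=> t.
rewrite opprD addrA subrr add0r cabsN cabsM cabs_real.
have : `|t| < e / (cabs v + 1) by near: t; apply: dnbhs0_lt; rewrite divr_gt0.
rewrite ltr_pdivlMr//; apply: le_lt_trans.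
by rewrite ler_wpM2l// lerDl.
Unshelve. all: by end_near. Qed.

Lemma dir_quot_id z v : dir_quot id z v @ 0^' --> v.
Proof.
apply/cvg_cabsP => e e0; near=> t.
have t0 : t != 0 by near: t; exact: nbhs_dnbhs_neq.
rewrite /dir_quot addrAC subrr add0r [t%:C * _]mulrC mulfK ?fmorph_eq0//.
by rewrite subrr cabs0.
Unshelve. all: by end_near. Qed.

Lemma dir_quot_exp n z v :
  dir_quot (fun w => w ^+ n) z v @ 0^' --> n%:R * z ^+ n.-1 * v.
Proof.
elim: n => [|n IH].
  rewrite [X in X @ _](_ : _ = fun=> 0) ?mul0r; last first.
    by apply/funext => t; rewrite /dir_quot subrr mul0r.
  exact: cvg_cst.
rewrite [X in X @ _](_ : _ = fun t : R =>
   dir_quot (fun w => w ^+ n) z v t * (z + t%:C * v) + z ^+ n * dir_quot id z v t).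
  have -> : n.+1%:R * z ^+ n.+1.-1 * v =
      n%:R * z ^+ n.-1 * v * z + z ^+ n * v.
    case: n {IH} => [|n] /=; first by rewrite !(mul0r, mul1r, add0r).
    by rewrite exprS -natr1; ring.
  apply: cvgD; first by apply: cvg_mulC; [exact: IH|exact: cvg_line].
  by apply: cvg_mulC; [exact: cvg_cst|exact: dir_quot_id].
by apply/funext => t; rewrite /dir_quot !exprSr; ring.
Qed.

Lemma dir_quotZ f z v d (k : C) : dir_quot f z v @ 0^' --> d ->
  dir_quot (fun w => k * f w) z v @ 0^' --> k * d.
Proof.
move=> fd; rewrite [X in X @ _](_ : _ = fun t => k * dir_quot f z v t).
  by apply: cvg_mulC; [exact: cvg_cst|exact: fd].
by apply/funext => t; rewrite /dir_quot mulrA -mulrBr.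
Qed.

(** Blocks of a power series rather than its sections: the difference of two
    sections is again a block. *)
Definition pblock c m n z : C := \sum_(m <= k < n) c k * z ^+ k.
Definition dpblock c m n z : C := \sum_(m <= k < n) c k * (k%:R * z ^+ k.-1).

Lemma dir_quot_pblock c m n z v :
  dir_quot (pblock c m n) z v @ 0^' --> dpblock c m n z * v.
Proof.
rewrite /pblock /dpblock; elim: (index_iota m n) => [|k r IH].
  rewrite [X in X @ _](_ : _ = fun=> 0) ?big_nil ?mul0r; first exact: cvg_cst.
  by apply/funext => t; rewrite /dir_quot !big_nil subrr mul0r.
rewrite [X in X @ _](_ : _ = dir_quot (fun w =>
    c k * w ^+ k + \sum_(k <- r) c k * w ^+ k) z v); last first.
  by apply/funext => t; rewrite /dir_quot !big_cons.
rewrite big_cons mulrDl; apply: dir_quotD IH.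
by rewrite -mulrA; apply: dir_quotZ; exact: dir_quot_exp.
Qed.

(** From the factorization of z^n - w^n by z - w, whose cofactor has n terms of
    modulus at most rho^(n-1). *)
Lemma exp_lipschitz n z w (rho : R) : cabs z <= rho -> cabs w <= rho ->
  cabs (z ^+ n - w ^+ n) <= n%:R * rho ^+ n.-1 * cabs (z - w).
Proof.
move=> zr wr; have rho0 : 0 <= rho by apply: le_trans zr; exact: cabs_ge0.
rewrite subrXX cabsM mulrC ler_wpM2r ?cabs_ge0//.
apply: le_trans (cabs_sum _ _ _) _.
have -> : n%:R * rho ^+ n.-1 = \sum_(i < n) rho ^+ n.-1.
  by rewrite sumr_const card_ord mulr_natl.
apply: ler_sum => i _.
have ile : (i <= n.-1)%N by rewrite -ltnS (ltn_predK (ltn_ord i)).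
rewrite cabsM !cabsX -[in leRHS](subnK ile) exprD.
by rewrite ler_pM ?exprn_ge0 ?cabs_ge0// lerXn2r// ?nnegrE ?cabs_ge0.
Qed.

Lemma pblock_lipschitz c m n z w (rho : R) : cabs z <= rho -> cabs w <= rho ->
  cabs (pblock c m n z - pblock c m n w) <=
    (\sum_(m <= k < n) k%:R * cabs (c k) * rho ^+ k.-1) * cabs (z - w).
Proof.
move=> zr wr; rewrite /pblock -sumrB mulr_suml.
apply: le_trans (cabs_sum _ _ _) _; apply: ler_sum => k _.
rewrite -mulrBr cabsM [k%:R * _]mulrC -!mulrA ler_wpM2l ?cabs_ge0// mulrA.
exact: exp_lipschitz.
Qed.

End DifferenceQuotients.

(** * Approximation of the Wirtinger derivatives by polynomials *)

Section HarmonicPolynomials.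
Context {R : realType}.
Local Notation C := (R[i]^o).
Implicit Types (f : C -> C) (z w v : C) (a b c : nat -> C).

Definition hpoly a b N z : C := pblock a 0 N z + (pblock b 1 N z)^*.

Lemma hblock_lipschitz a b m n z w (rho : R) : cabs z <= rho -> cabs w <= rho ->
  cabs (pblock a m n z + (pblock b m n z)^* - (pblock a m n w + (pblock b m n w)^*))
   <= (\sum_(m <= k < n) k%:R * (cabs (a k) + cabs (b k)) * rho ^+ k.-1) *
     cabs (z - w).
Proof.
move=> zr wr.
have -> : \sum_(m <= k < n) k%:R * (cabs (a k) + cabs (b k)) * rho ^+ k.-1 =
    \sum_(m <= k < n) k%:R * cabs (a k) * rho ^+ k.-1 +
    \sum_(m <= k < n) k%:R * cabs (b k) * rho ^+ k.-1.
  by rewrite -big_split /=; apply: eq_bigr => k _; ring.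
have regroup (p q r s : C) : p + q - (r + s) = (p - r) + (q - s) by ring.
rewrite regroup mulrDl; apply: le_trans (cabsD _ _) _.
apply: lerD; first exact: pblock_lipschitz.
rewrite -[leLHS]cabs_conj.
have -> : ((pblock b m n z)^* - (pblock b m n w)^*)^* =
    pblock b m n z - pblock b m n w.
  by rewrite rmorphB; congr (_ - _); exact: conjcK.
exact: pblock_lipschitz.
Qed.

Lemma harmonic_expansion_blocks f a b z : harmonic_expansion f a b ->
  unit_disc z -> exists u v : C,
    [/\ (fun N => pblock a 0 N z) @ \oo --> u,
        (fun N => pblock b 1 N z) @ \oo --> v & f z = u + v^*].
Proof.
move=> fab /fab[u [v [au bv ->]]]; exists u, (v^* : C); split; first exact: au.
  apply: cvg_trans (cvg_conj bv); apply: near_eq_cvg; apply: nearW => N.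
  rewrite [LHS]rmorph_sum; apply: eq_bigr => k _.
  by rewrite rmorphM rmorphXn; congr (_ * _ ^+ _); exact: conjcK.
by congr (_ + _); exact: (esym (conjcK v)).
Qed.

Lemma hpoly_cvg f a b z : harmonic_expansion f a b ->
  unit_disc z -> (fun N => hpoly a b N z) @ \oo --> f z.
Proof.
move=> fab /(harmonic_expansion_blocks fab)[u [v [au bv ->]]].
by apply: cvgD; [exact: au|exact: cvg_conj].
Qed.

(** The general term of a convergent series is a difference of two consecutive
    partial sums, hence bounded. *)
Lemma pblock_cvg_bounded c m (x : R) (l : C) : 0 <= x ->
  (fun N => pblock c m N x%:C) @ \oo --> l ->
  exists B, forall k, (m <= k)%N -> cabs (c k) * x ^+ k <= B.
Proof.
move=> x0 /cvg_cabsP/(_ 1 ltr01)[N0 _ cN].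
(* From N0 on each term is at most 1 + 1; the finitely many others are summed. *)
exists (2 + \sum_(0 <= j < N0) cabs (c j) * x ^+ j) => k mk.
have term0 j : 0 <= cabs (c j) * x ^+ j by rewrite mulr_ge0 ?cabs_ge0 ?exprn_ge0.
have [kN|Nk] := ltnP k N0.
  rewrite big_mkord (bigD1 (Ordinal kN))//= addrCA lerDl addr_ge0// sumr_ge0//.
apply: (@le_trans _ _ 2); last by rewrite lerDl sumr_ge0.
have -> : cabs (c k) * x ^+ k = cabs (c k * x%:C ^+ k).
  by rewrite cabsM cabsX cabs_real ger0_norm.
have -> : c k * x%:C ^+ k =
    (l - pblock c m k x%:C) - (l - pblock c m k.+1 x%:C).
  rewrite /pblock big_nat_recr//=; ring.
apply: le_trans (cabsB _ _) _.
by apply: ltW; rewrite (_ : 2 = 1 + 1)// ltrD//; apply: cN => //=; exact: leqW.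
Qed.

(** Since n s^n <= 1 + s + ... + s^(n-1).  It absorbs the factor n of a
    differentiated power series at the price of a slightly larger ratio. *)
Lemma natr_geometric_le (s : R) n : 0 <= s < 1 -> n%:R * s ^+ n <= (1 - s)^-1.
Proof.
move=> /andP[s0 s1]; rewrite -[leRHS]mul1r ler_pdivlMr ?subr_gt0//.
apply: (@le_trans _ _ (1 - s ^+ n)); last by rewrite lerBlDr lerDl exprn_ge0.
elim: n => [|n IH]; first by rewrite expr0 !mul0r subrr.
have sn : 0 <= s ^+ n.+1 <= 1 by rewrite exprn_ge0//= exprn_ile1// ltW.
move: sn; rewrite exprS -natr1 => /andP[sn0 sn1].
have := ler_wpM2l s0 IH; set p := s ^+ n in sn0 sn1 *; nra.
Qed.

(** Compare with a radius sg in ]rho, 1[: the terms a_n sg^n are bounded, and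
    n (rho / sg)^n is dominated by a geometric sequence of ratio sqrt (rho / sg). *)
Lemma harmonic_coef_summable f a b (rho : R) : harmonic_expansion f a b ->
  0 < rho < 1 ->
  cvgn (series (fun k => k%:R * (cabs (a k) + cabs (b k)) * rho ^+ k.-1)).
Proof.
move=> fab /andP[rho0 rho1].
have [sg rsg sg1] : exists2 sg, rho < sg & sg < 1.
  by exists ((1 + rho) / 2); lra.
have sg0 : 0 < sg by exact: lt_trans rsg.
have rs : rho / sg < 1 by rewrite ltr_pdivrMr// mul1r.
have /(harmonic_expansion_blocks fab)[u [v [au bv _]]] : unit_disc (sg%:C : C).
  by rewrite /unit_disc /= cabs_real gtr0_norm.
have [A hA] := pblock_cvg_bounded (ltW sg0) au.
have [B hB] := pblock_cvg_bounded (ltW sg0) bv.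
(* Half of (rho / sg)^n = s^n * s^n pays for the factor n. *)
pose s := Num.sqrt (rho / sg).
have s0 : 0 <= s by rewrite sqrtr_ge0.
have ss : s ^+ 2 = rho / sg by rewrite sqr_sqrtr// divr_ge0// ltW.
have s1 : s < 1 by rewrite -(@ltr_pXn2r _ 2)// ?nnegrE// ss expr1n.
apply: (@series_le_cvg _ _ (geometric ((A + B) / rho / (1 - s)) s)).
- by move=> k; rewrite !mulr_ge0// ?addr_ge0 ?cabs_ge0// exprn_ge0 ?ltW.
- move=> k; rewrite /geometric/= mulr_ge0 ?exprn_ge0// !mulr_ge0//.
  + apply: addr_ge0.
      by apply: le_trans (hA 0%N isT); rewrite mulr1 cabs_ge0.
    by apply: le_trans (hB 1%N isT); rewrite mulr_ge0 ?cabs_ge0 ?exprn_ge0 ?ltW.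
  + by rewrite invr_ge0 ltW.
  + by rewrite invr_ge0 subr_ge0 ltW.
- case=> [|k].
    rewrite !mul0r /geometric/= mulr1 !mulr_ge0//.
    + apply: addr_ge0.
        by apply: le_trans (hA 0%N isT); rewrite mulr1 cabs_ge0.
      by apply: le_trans (hB 1%N isT); rewrite mulr_ge0 ?cabs_ge0 ?exprn_ge0 ?ltW.
    + by rewrite invr_ge0 ltW.
    + by rewrite invr_ge0 subr_ge0 ltW.
  set n := k.+1.
  have rhoE : rho ^+ n.-1 = sg ^+ n / rho * (s ^+ n * s ^+ n).
    rewrite -exprMn -expr2 ss expr_div_n (exprS rho k) /=.
    have sgn0 := expf_neq0 n (lt0r_neq0 sg0); have rn0 := lt0r_neq0 rho0.
    by field; rewrite sgn0 rn0.
  have -> : n%:R * (cabs (a n) + cabs (b n)) * rho ^+ n.-1 =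
      (cabs (a n) * sg ^+ n + cabs (b n) * sg ^+ n) / rho *
      (n%:R * s ^+ n) * s ^+ n by rewrite rhoE; ring.
  rewrite /geometric/= ler_wpM2r ?exprn_ge0// ler_pM ?natr_geometric_le ?s0//.
  + rewrite divr_ge0 ?(ltW rho0)// addr_ge0// mulr_ge0 ?cabs_ge0//.
      by rewrite exprn_ge0 ?(ltW sg0).
    by rewrite exprn_ge0 ?(ltW sg0).
  + by rewrite mulr_ge0 ?exprn_ge0.
  + by rewrite ler_wpM2r ?invr_ge0 ?(ltW rho0)// lerD ?hA ?hB.
- by apply: is_cvg_geometric_series; rewrite ger0_norm.
Qed.

Lemma cvg_series_tail (T : nat -> R) (e : R) : (forall k, 0 <= T k) ->
  cvgn (series T) -> 0 < e ->
  \forall N \near \oo, forall M, (N <= M)%N -> \sum_(N <= k < M) T k <= e.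
Proof.
move=> T0 cT e0.
have ndT : nondecreasing_seq (series T) by exact: nondecreasing_series.
have /cvgrPdist_lt/(_ _ e0) := cT.
apply: filterS => N hN M NM; rewrite -(sub_series_geq _ NM).
apply: le_trans (ltW hN); apply: le_trans (ler_norm _).
by rewrite lerB// nondecreasing_cvgn_le.
Qed.

(** Between two sections of the expansion the difference is a finite block, with
    Lipschitz constant at most a tail of the summable series of [harmonic_coef_summable];
    the estimate is uniform in the longer section, so it passes to the limit f. *)
Lemma harmonic_tail_lipschitz f a b (rho e : R) : harmonic_expansion f a b ->
  0 < rho < 1 -> 0 < e ->
  \forall N \near \oo, forall z w, cabs z <= rho -> cabs w <= rho ->
    cabs ((f z - hpoly a b N z) - (f w - hpoly a b N w)) <= e * cabs (z - w).
Proof.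
move=> fab rho01 e0; have /andP[rho0 rho1] := rho01.
pose T k := k%:R * (cabs (a k) + cabs (b k)) * rho ^+ k.-1.
have T0 k : 0 <= T k by rewrite !mulr_ge0// ?addr_ge0 ?cabs_ge0// exprn_ge0 ?ltW.
have tail := cvg_series_tail T0 (harmonic_coef_summable fab rho01) e0.
near=> N => z w zr wr.
have N1 : (1 <= N)%N by near: N; exact: nbhs_infty_ge.
have tN : forall M, (N <= M)%N -> \sum_(N <= k < M) T k <= e.
  by near: N; exact: tail.
apply/ler_addgt0Pr => d d0.
have d2 : 0 < d / 2 by rewrite divr_gt0.
have hz := hpoly_cvg fab (le_lt_trans zr rho1).
have hw := hpoly_cvg fab (le_lt_trans wr rho1).
have [M [NM hMz hMw]] : exists M, [/\ (N <= M)%N,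
    cabs (f z - hpoly a b M z) < d / 2 & cabs (f w - hpoly a b M w) < d / 2].
  move/cvg_cabsP : hz => /(_ _ d2)[M1 _ h1].
  move/cvg_cabsP : hw => /(_ _ d2)[M2 _ h2].
  exists (maxn N (maxn M1 M2)); split; first exact: leq_maxl.
    by apply: h1; rewrite /= !leq_max leqnn orbT.
  by apply: h2; rewrite /= !leq_max leqnn !orbT.
have blockE x : hpoly a b M x - hpoly a b N x =
    pblock a N M x + (pblock b N M x)^*.
  rewrite /hpoly /pblock (big_cat_nat (n := N) (p := M))//=.
  rewrite (big_cat_nat (m := 1) (n := N) (p := M))//= rmorphD.
  have cancel (p q r s : C) : p + q + (r + s) - (p + r) = q + s by ring.
  exact: cancel.
have regroup (p q r s t u x y : C) : t - q = x -> u - s = y ->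
    p - q - (r - s) = (x - y) + ((p - t) - (r - u)) by move=> <- <-; ring.
rewrite (regroup _ _ _ _ _ _ _ _ (blockE z) (blockE w)).
apply: le_trans (cabsD _ _) _.
apply: lerD; last first.
  rewrite (splitr d); apply: le_trans (cabsB _ _) _.
  exact: lerD (ltW hMz) (ltW hMw).
apply: le_trans (ler_wpM2r (cabs_ge0 _) (tN _ NM)).
exact: hblock_lipschitz.
Unshelve. all: by end_near. Qed.

(** With p, q the derivatives of f in x and y, the section has derivatives A + B and
    'i A - 'i B; the error of each Wirtinger derivative is thus half the sum of the
    two directional errors, up to a unimodular factor. *)
Lemma wirtinger_regroup (p q A B : C) :
  (p - 'i * q) / 2 - A = ((p - (A + B)) + 'i * - (q - (A * 'i - 'i * B))) / 2 /\
  (p + 'i * q) / 2 - B = ((p - (A + B)) + 'i * (q - (A * 'i - 'i * B))) / 2.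
Proof.
suff gen (j : C) : j * j = -1 ->
    (p - j * q) / 2 - A = ((p - (A + B)) + j * - (q - (A * j - j * B))) / 2 /\
    (p + j * q) / 2 - B = ((p - (A + B)) + j * (q - (A * j - j * B))) / 2.
  by apply: gen; exact: (sqr_i R).
have n2 : 2 != 0 :> C by rewrite pnatr_eq0.
move=> jj; split.
  have -> : j * - (q - (A * j - j * B)) = - (j * q) + (j * j) * (A - B) by ring.
  by rewrite jj; field.
have -> : j * (q - (A * j - j * B)) = j * q - (j * j) * (A - B) by ring.
by rewrite jj; field.
Qed.

Lemma wirtinger_approx f a b (rho e : R) :
  (forall z, unit_disc z -> has_partials f z) -> harmonic_expansion f a b ->
  0 < rho < 1 -> 0 < e ->
  \forall N \near \oo, forall z, cabs z < rho ->
    cabs (d_z f z - dpblock a 0 N z) <= e /\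
    cabs (d_zbar f z - (dpblock b 1 N z)^*) <= e.
Proof.
move=> pf fab rho01 e0; have /andP[rho0 rho1] := rho01.
apply: filterS (harmonic_tail_lipschitz fab rho01 e0) => N lip z zr.
have dh v : dir_quot (hpoly a b N) z v @ 0^' -->
    (dpblock a 0 N z * v + (dpblock b 1 N z * v)^* : C).
  apply: dir_quotD; first exact: dir_quot_pblock.
  by apply: dir_quot_conj; exact: dir_quot_pblock.
have zd := pf _ (lt_trans zr rho1).
have lip' : forall w w', cabs w < rho -> cabs w' < rho ->
  cabs (f w - hpoly a b N w - (f w' - hpoly a b N w')) <= e * cabs (w - w').
  by move=> w w' /ltW wr /ltW wr'; exact: lip.
have ex := lipschitz_dir_quot_le lip' zr cabs1
  (dir_quotB (partial_x_dir_quot zd) (dh 1)).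
have ey := lipschitz_dir_quot_le lip' zr cabs_i
  (dir_quotB (partial_y_dir_quot zd) (dh 'i)).
have half x y : cabs x <= e -> cabs y <= e -> cabs ((x + 'i * y) / 2 : C) <= e.
  move=> xe ye; rewrite cabsM cabsV (cabs_nat 2) ler_pdivrMr//.
  apply: le_trans (cabsD _ _) _; rewrite cabsM cabs_i mul1r; lra.
set A := dpblock a 0 N z in ex ey *; set B := dpblock b 1 N z in ex ey *.
have conjBi : (B * 'i)^* = - ('i * B^*) :> C.
  apply/eqP; rewrite eq_complex; case: (B) => x y /=.
  by apply/andP; split; apply/eqP; ring.
have ex' : cabs (partial_x f z - (A + B^*)) <= e.
  have -> : A + B^* = A * 1 + (B * 1)^* by rewrite !mulr1.
  exact: ex.
have ey' : cabs (partial_y f z - (A * 'i - 'i * B^*)) <= e.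
  have -> : A * 'i - 'i * B^* = A * 'i + (B * 'i)^*.
    by congr (_ + _); exact: (esym conjBi).
  exact: ey.
have [dz dzbar] := wirtinger_regroup (partial_x f z) (partial_y f z) A (B^*).
rewrite /d_z /d_zbar dz dzbar; split; last exact: half.
by apply: half => //; rewrite cabsN.
Qed.

End HarmonicPolynomials.

(** * Averages over the roots of unity, and distortion *)

Section RootsOfUnityAverage.
Context {R : realType}.
Local Notation C := (R[i]^o).
Implicit Types (c : nat -> C) (x t : R).

Lemma cis_neq1 x : 0 < x < 2 * pi -> cis x != 1 :> C.
Proof.
move=> /andP[x0 x2pi]; apply/eqP => /(congr1 (@complex.Re R)) /= cosx.
have s0 : 0 < sin (x / 2) by apply: sin_gt0_pi; apply/andP; split; lra.
have x2 : x = (x / 2) *+ 2 by rewrite mulr2n; lra.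
have := mulr_gt0 s0 s0; move: cosx; rewrite {1}x2 cos_mulr2n cos2sin2 -expr2 mulr2n.
by move=> h; lra.
Qed.

Definition root_angle N (k : nat) : R := (2 * pi / N%:R) *+ k.

Lemma cis_2pi : cis (2 * pi) = 1 :> C.
Proof. by rewrite /cis mulr_natl cos2pi sin2pi. Qed.

Lemma sum_roots_of_unity N s : ~~ (N %| s)%N ->
  \sum_(k < N) (cis (root_angle N k) : C) ^+ s = 0.
Proof.
case: N => [|N] Ns; first by rewrite big_ord0.
pose om : C := cis (2 * pi / N.+1%:R).
have omN : om ^+ N.+1 = 1.
  by rewrite /om -cis_mulrn -[X in cis X]mulr_natr divfK ?cis_2pi ?pnatr_eq0.
have oms : om ^+ s != 1.
  rewrite (divn_eq s N.+1) exprD mulnC exprM omN expr1n mul1r -cis_mulrn.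
  apply: cis_neq1; rewrite -[_ *+ (s %% N.+1)]mulr_natr.
  have pi0 := @pi_gt0 R.
  have rpos : (0 : R) < (s %% N.+1)%:R by rewrite ltr0n lt0n.
  have rN : (s %% N.+1)%:R < N.+1%:R :> R by rewrite ltr_nat ltn_pmod.
  have N0 : (0 : R) < N.+1%:R by rewrite ltr0n.
  have twopi : 0 < 2 * pi :> R by rewrite mulr_gt0.
  apply/andP; split; first by rewrite mulr_gt0// divr_gt0.
  by rewrite mulrAC ltr_pdivrMr// ltr_pM2l.
apply: (mulfI (_ : om ^+ s - 1 != 0)); first by rewrite subr_eq0.
rewrite mulr0.
under eq_bigr => k _ do rewrite /root_angle cis_mulrn -/om -exprM mulnC exprM.
by rewrite -subrX1 -exprM mulnC exprM omN expr1n subrr.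
Qed.

(** Multiplying by om^(k (N - q)) instead of om^(- k q) keeps exponents natural;
    summation over k then kills every monomial but the q-th, because
    j + (N - q) is a multiple of N for no other j < N. *)
Lemma coef_le_average c N q (r : R) : (q < N)%N -> 0 <= r ->
  N%:R * (cabs (c q) * r ^+ q) <=
    \sum_(k < N) cabs (\sum_(0 <= j < N) c j * (r%:C * cis (root_angle N k)) ^+ j).
Proof.
move=> qN r0.
have key : \sum_(k < N) (cis (root_angle N k) : C) ^+ (N - q) *
    (\sum_(0 <= j < N) c j * (r%:C * cis (root_angle N k)) ^+ j) =
    N%:R * (c q * r%:C ^+ q).
  under eq_bigr => k _ do rewrite mulr_sumr.
  rewrite exchange_big /= big_mkord (bigD1 (Ordinal qN))//= [X in _ + X]big1.
    rewrite addr0; under eq_bigr => k _.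
      rewrite mulrCA exprMn (mulrCA _ (_ ^+ q)) -exprD subnK ?(ltnW qN)//.
      rewrite /root_angle -cis_mulrn -mulrnA mulnC mulrnA -[_ *+ N]mulr_natr.
      rewrite divfK ?cis_mulrn ?cis_2pi ?expr1n ?mulr1; last first.
        by rewrite pnatr_eq0 -lt0n (leq_ltn_trans _ qN).
      over.
    by rewrite sumr_const card_ord mulr_natl.
  move=> j jq.
  under eq_bigr => k _.
    rewrite mulrCA exprMn (mulrCA _ (_ ^+ j)) -exprD mulrA; over.
  rewrite -mulr_sumr sum_roots_of_unity ?mulr0//.
  apply: contra jq => /dvdnP[m jm]; apply/eqP/val_inj => /=.
  have := ltn_ord j; by case: m jm => [|[|m]] jm; nia.
apply: le_trans (_ : cabs (N%:R * (c q * r%:C ^+ q)) <= _).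
  by rewrite !cabsM cabs_nat cabsX cabs_real ger0_norm.
rewrite -key; apply: le_trans (cabs_sum _ _ _) _; apply: ler_sum => k _.
by rewrite cabsM cabsX cabs_cis expr1n mul1r.
Qed.

End RootsOfUnityAverage.

Section Distortion.
Context {R : realType}.
Local Notation C := (R[i]^o).
Implicit Types (f : C -> C) (z : C) (t : R).

(** Put D = |f_z| + |f_zbar| and l = |f_z| - |f_zbar|, so that J_f = D l and
    l <= g for g the modulus on the right.  If D > sqrt K' + K g, then
    D^2 > sqrt K' D + K g D >= K' + K J_f.  Here l may well be negative. *)
Lemma norm_D_le (K K' : R) f z t : 1 <= K -> 0 <= K' ->
  norm_D f z ^+ 2 <= K * Defs.jacobian f z + K' ->
  norm_D f z <= Num.sqrt K' + K * cabs (d_z f z + cis t * d_zbar f z).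
Proof.
rewrite /norm_D /Defs.jacobian => K1 K'0; set A := cabs (d_z f z).
set B := cabs (d_zbar f z); set g := cabs (_ + _) => DJ.
have A0 : 0 <= A by exact: cabs_ge0.
have B0 : 0 <= B by exact: cabs_ge0.
have g0 : 0 <= g by exact: cabs_ge0.
have ABg : A - B <= g.
  rewrite lerBlDr /A; have -> : B = cabs (cis t * d_zbar f z).
    by rewrite cabsM cabs_cis mul1r.
  apply: le_trans (cabsB _ _); rewrite addrK; exact: lexx.
have s2 := sqr_sqrtr K'0; have s0 := sqrtr_ge0 K'.
set s := Num.sqrt K' in s2 s0 *.
rewrite leNgt; apply/negP => lt.
have Kg : 0 <= K * g by rewrite mulr_ge0// (le_trans ler01).
have D0 : 0 <= A + B by rewrite addr_ge0.
have JE : A ^+ 2 - B ^+ 2 = (A + B) * (A - B) by ring.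
have h1 : (A + B) * (A - B) <= (A + B) * g by rewrite ler_wpM2l.
have h2 : K * (A ^+ 2 - B ^+ 2) <= (A + B) * (K * g).
  by rewrite JE [leRHS]mulrCA ler_wpM2l ?(le_trans ler01).
have Ds : s <= A + B by lra.
have h3 : 0 <= (A + B) * (A + B - s - K * g) by rewrite mulr_ge0//; lra.
have Dpos : 0 < A + B by lra.
have h4 : 0 < (A + B) * (A + B - s - K * g) by rewrite mulr_gt0//; lra.
have h5 : s ^+ 2 <= (A + B) * s by rewrite expr2 ler_wpM2r.
nra.
Qed.

End Distortion.

(** * Integration along radii *)

Section RadialEstimate.
Context {R : realType}.
Local Notation C := (R[i]^o).
Local Notation mu := (@lebesgue_measure R).
Implicit Types (f : C -> C) (z : C) (t r : R).

(** The integrand of the radial length. *)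
Definition radial_speed f t r : R :=
  cabs (d_z f (r%:C * cis t) + cis (- (2 * t)) * d_zbar f (r%:C * cis t)).

Lemma radial_speed_ge0 f t r : 0 <= radial_speed f t r.
Proof. exact: cabs_ge0. Qed.

Lemma wirtinger_continuous f z : class_C1 unit_disc f -> unit_disc z ->
  d_z f w @[w --> z] --> d_z f z /\ d_zbar f w @[w --> z] --> d_zbar f z.
Proof.
move=> [_ cx cy] zD; have FF : Filter (nbhs z) by exact: nbhs_filter.
have {}cx : partial_x f w @[w --> z] --> partial_x f z by apply: cx; rewrite inE.
have {}cy : partial_y f w @[w --> z] --> partial_y f z by apply: cy; rewrite inE.
have ciy (i : C) : i * partial_y f w @[w --> z] --> i * partial_y f z.
  apply: cvg_mulC; last exact: cy.
  exact: cvg_cst.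
split; apply: cvg_mulC;
  try exact: cvg_cst.
  exact: (@cvgB _ _ _ _ FF _ _ _ _ cx (ciy _)).
exact: (@cvgD _ _ _ _ FF _ _ _ _ cx (ciy _)).
Qed.

Lemma radial_speed_continuous f t r : class_C1 unit_disc f -> 0 <= r < 1 ->
  {for r, continuous (radial_speed f t)}.
Proof.
move=> fC1 /andP[r0 r1].
have rD : unit_disc (r%:C * cis t : C) by rewrite /unit_disc /= cabs_polar.
have [cz czbar] := wirtinger_continuous fC1 rD.
have cp : (x%:C * cis t : C) @[x --> r] --> (r%:C * cis t : C).
  apply: cvg_mulC; last exact: cvg_cst.
  exact: real_complex_continuous.
have {}cz := cvg_comp _ _ cp cz.
have {}czbar := cvg_comp _ _ cp czbar.
have czbar' : cis (- (2 * t)) * d_zbar f (x%:C * cis t) @[x --> r] -->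
    cis (- (2 * t)) * d_zbar f (r%:C * cis t).
  by apply: cvg_mulC; [exact: cvg_cst|exact: czbar].
exact: cvg_comp (cvgD cz czbar') (@cabs_continuous R _).
Qed.

Lemma measurable_radial_speed f t (rho : R) : class_C1 unit_disc f -> rho < 1 ->
  measurable_fun `[0, rho] (radial_speed f t).
Proof.
move=> fC1 rho1; apply: subspace_continuous_measurable_fun => //.
apply: continuous_in_subspaceT => r; rewrite inE /= in_itv /= => /andP[r0 rr].
by apply: radial_speed_continuous => //; rewrite r0 (le_lt_trans rr).
Qed.

Lemma integral_monomial (rho : R) n : 0 < rho ->
  (\int[mu]_(r in `[0%R, rho]) (n.+1%:R * r ^+ n)%:E)%E = (rho ^+ n.+1)%:E.
Proof.
move=> rho0.
rewrite (@continuous_FTC2 _ _ (fun r : R => r ^+ n.+1) _ _ rho0).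
- by rewrite expr0n /= sube0.
- apply: continuous_in_subspaceT => r _.
  by apply: cvgM; [exact: cvg_cst|exact: exprn_continuous].
- split.
  + by move=> r _; exact: exprn_derivable.
  + by apply: cvg_at_right_filter; exact: exprn_continuous.
  + by apply: cvg_at_left_filter; exact: exprn_continuous.
- by move=> r _; rewrite exp_derive1.
Qed.

Lemma radial_length_ge0 f r t : (0 <= radial_length f r t)%E.
Proof. by apply: integral_ge0 => x _; rewrite lee_fin cabs_ge0. Qed.

Lemma radial_length_le_sup f r t : 0 <= r < 1 -> 0 <= t <= 2 * pi ->
  (radial_length f r t <= sup_radial_length f)%E.
Proof.
move=> r01 t02; apply: (@le_trans _ _ (radial_length1 f t)).
  by apply: ereal_sup_ubound; exists r.
by apply: ereal_sup_ubound; exists t.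
Qed.

Lemma root_angle_bound N k : (k < N)%N -> 0 <= (root_angle N k : R) <= 2 * pi.
Proof.
move=> kN; rewrite /root_angle -[_ *+ k]mulr_natr.
have N0 : (0 : R) < N%:R by rewrite ltr0n (leq_ltn_trans _ kN).
have kN' : (k%:R : R) <= N%:R by rewrite ler_nat ltnW.
have twopi : 0 <= 2 * pi :> R by rewrite mulr_ge0// pi_ge0.
apply/andP; split; first by rewrite mulr_ge0// divr_ge0// ltW.
by rewrite mulrAC ler_pdivrMr// ler_wpM2l.
Qed.

(** The monomial on the left integrates to rho^(n+1), and each of the N radial
    integrals on the right is a radial length, hence at most L. *)
Lemma integrate_radial_average f (N n : nat) (c S K L rho : R) :
  class_C1 unit_disc f -> (0 < N)%N -> 0 < rho < 1 -> 0 <= c -> 0 <= S -> 0 <= K ->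
  sup_radial_length f = L%:E ->
  (forall r, 0 <= r <= rho ->
     N%:R * (c * (n.+1%:R * r ^+ n)) <=
     N%:R * S + K * \sum_(k < N) radial_speed f (root_angle N k) r) ->
  c * rho ^+ n.+1 <= S + K * L.
Proof.
move=> fC1 N0 /andP[rho0 rho1] c0 S0 K0 LE pw.
have mD : measurable (`[0%R, rho] : set R) by [].
have mS k : measurable_fun (`[0%R, rho] : set R)
    (fun r => (radial_speed f (root_angle N k) r)%:E).
  by apply/measurable_EFinP; exact: measurable_radial_speed.
have msum : measurable_fun (`[0%R, rho] : set R)
    (fun r => \sum_(k < N) (radial_speed f (root_angle N k) r)%:E)%E.
  by apply: emeasurable_sum => k; exact: mS.
have sum0 r : (0 <= \sum_(k < N) (radial_speed f (root_angle N k) r)%:E)%E.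
  by apply: sume_ge0 => k _; rewrite lee_fin radial_speed_ge0.
have Npos : 0 < N%:R :> R by rewrite ltr0n.
have NS0 : (0 <= (N%:R * S)%:E)%E by rewrite lee_fin mulr_ge0.
have : (\int[mu]_(r in `[0%R, rho]) ((N%:R * c)%:E * (n.+1%:R * r ^+ n)%:E) <=
  \int[mu]_(r in `[0%R, rho]) ((N%:R * S)%:E +
     K%:E * \sum_(k < N) (radial_speed f (root_angle N k) r)%:E))%E.
  apply: ge0_le_integral => //.
  - move=> r /=; rewrite in_itv /= => /andP[r0 _].
    by rewrite -EFinM lee_fin !mulr_ge0 ?exprn_ge0.
  - apply: measurable_funeM; apply/measurable_EFinP.
    by apply: measurable_funM => //; exact: measurable_funX.
  - by apply: emeasurable_funD => //; exact: measurable_funeM.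
  - move=> r /=; rewrite in_itv /= => rr.
    by rewrite sumEFin -!EFinM -EFinD lee_fin -mulrA; exact: pw.
have -> : (\int[mu]_(r in `[0%R, rho]) ((N%:R * c)%:E * (n.+1%:R * r ^+ n)%:E) =
    (N%:R * c * rho ^+ n.+1)%:E)%E.
  rewrite ge0_integralZl_EFin ?integral_monomial//.
  - by move=> r /=; rewrite in_itv /= => /andP[r0 _]; rewrite lee_fin mulr_ge0 ?exprn_ge0.
  - by apply/measurable_EFinP; apply: measurable_funM => //; exact: measurable_funX.
  - by rewrite mulr_ge0// ltW.
rewrite ge0_integralD//; last 2 first.
- by move=> r _; rewrite mule_ge0.
- exact: measurable_funeM.
rewrite integral_cst//= lebesgue_measure_itv /= lte_fin rho0 sube0.
rewrite ge0_integralZl_EFin//.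
have -> : (\int[mu]_(r in `[0%R, rho])
     (\sum_(k < N) (radial_speed f (root_angle N k) r)%:E) =
   \sum_(k < N) \int[mu]_(r in `[0%R, rho])
     (radial_speed f (root_angle N k) r)%:E)%E.
  apply: (ge0_integral_sum mu mD (fun k : 'I_N => mS k)) => k r _.
  by rewrite lee_fin radial_speed_ge0.
have sumle : (\sum_(k < N) \int[mu]_(r in `[0%R, rho])
    (radial_speed f (root_angle N k) r)%:E <= (N%:R * L)%:E)%E.
  apply: (@le_trans _ _ (\sum_(k < N) L%:E)%E).
    apply: lee_sum => k _; rewrite -LE.
    by apply: (@radial_length_le_sup f rho); rewrite ?rho1 ?(ltW rho0)// root_angle_bound.
  by rewrite sumEFin sumr_const card_ord mulr_natl.
have K0E : (0 <= K%:E)%E by rewrite lee_fin.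
move=> /le_trans /(_ (leeD2l _ (lee_wpmul2l K0E sumle))).
rewrite -!EFinM -EFinD lee_fin => h.
have : N%:R * (c * rho ^+ n.+1) <= N%:R * (S * rho + K * L) by nra.
rewrite ler_pM2l// => /le_trans; apply; rewrite lerD2r.
by rewrite ler_piMr// ltW.
Qed.

End RadialEstimate.

(** * The coefficient bound *)

Section CoefficientBound.
Context {R : realType}.
Local Notation C := (R[i]^o).
Implicit Types (f : C -> C) (a b : nat -> C) (z : C).

Lemma dpblock_shift a N z :
  dpblock a 1 N.+1 z = \sum_(0 <= j < N) (a j.+1 * j.+1%:R) * z ^+ j.
Proof. by rewrite /dpblock big_add1; apply: eq_bigr => j _; rewrite mulrA. Qed.

Lemma dpblock0 a N z : dpblock a 0 N.+1 z = dpblock a 1 N.+1 z.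
Proof.
rewrite /dpblock (big_nat_recl N 0%N)//= mul0r mulr0 add0r [in RHS]big_add1.
by apply: eq_bigr.
Qed.

Lemma dpblock_coef_le_average a N m (r : R) : (m < N)%N -> 0 <= r ->
  N%:R * (cabs (a m.+1) * (m.+1%:R * r ^+ m)) <=
  \sum_(k < N) cabs (dpblock a 1 N.+1 (r%:C * cis (root_angle N k))).
Proof.
move=> mN r0; under eq_bigr => k _ do rewrite dpblock_shift.
apply: le_trans (coef_le_average (fun j => a j.+1 * j.+1%:R) mN r0).
by rewrite cabsM cabs_nat !mulrA.
Qed.

(** For N large, coefficients of the differentiated sections are bounded by averages of
    ||D_f|| + e over the N-th roots of unity, and [norm_D_le] applies at each point. *)
Lemma coef_average_le_speed (K K' : R) f a b (rho e : R) m :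
  1 <= K -> 0 <= K' ->
  (forall z, unit_disc z -> has_partials f z) ->
  (forall z, unit_disc z -> norm_D f z ^+ 2 <= K * Defs.jacobian f z + K') ->
  harmonic_expansion f a b -> 0 < rho < 1 -> 0 < e ->
  exists2 N, (m < N)%N & forall r, 0 <= r < rho ->
    N%:R * ((cabs (a m.+1) + cabs (b m.+1)) * (m.+1%:R * r ^+ m)) <=
    N%:R * (Num.sqrt K' + e) +
      K * \sum_(k < N) radial_speed f (root_angle N k) r.
Proof.
move=> K1 K'0 pf qc fab rho01 e0; have /andP[rho0 rho1] := rho01.
have e2 : 0 < e / 2 by rewrite divr_gt0.
have [N0 _ approx] := wirtinger_approx pf fab rho01 e2.
pose N := maxn N0 m.+1; exists N; first by rewrite leq_max leqnn orbT.
have mN : (m < N)%N by rewrite leq_max leqnn orbT.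
have {}approx z : cabs z < rho ->
    cabs (dpblock a 1 N.+1 z) + cabs (dpblock b 1 N.+1 z) <= norm_D f z + e.
  move=> zr; have [] := approx N.+1 _ z zr; first by rewrite /= leqW// leq_maxl.
  rewrite dpblock0 => az bz; rewrite -[cabs (dpblock b 1 N.+1 z)]cabs_conj /norm_D.
  rewrite (splitr e) addrACA; apply: lerD.
    rewrite -lerBlDl; apply: le_trans az; rewrite cabs_distC lerBlDr.
    by apply: le_trans (cabsD _ _); rewrite subrK.
  rewrite -lerBlDl; apply: le_trans bz; rewrite cabs_distC lerBlDr.
  by apply: le_trans (cabsD _ _); rewrite subrK.
move=> r /andP[r0 rr].
rewrite mulrDl mulrDr; apply: le_trans (lerD (dpblock_coef_le_average _ mN r0)
  (dpblock_coef_le_average _ mN r0)) _.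
rewrite -big_split /= mulr_sumr.
have -> : N%:R * (Num.sqrt K' + e) = \sum_(k < N) (Num.sqrt K' + e).
  by rewrite sumr_const card_ord mulr_natl.
rewrite -big_split /=; apply: ler_sum => k _.
have zE : cabs (r%:C * cis (root_angle N k) : C) = r by rewrite cabs_polar.
apply: le_trans (approx _ _) _; first by rewrite zE.
rewrite [leRHS]addrAC lerD2r; apply: norm_D_le => //; apply: qc.
by rewrite /unit_disc /= zE (lt_trans rr).
Qed.

Lemma le_of_le_mul_expn (c M : R) n :
  (forall rho, 0 < rho < 1 -> c * rho ^+ n <= M) -> c <= M.
Proof.
move=> cM; have cv : c * x ^+ n @[x --> 1^'-] --> c * 1 ^+ n.
  by apply: cvgMr; apply: cvg_at_left_filter; exact: exprn_continuous.
rewrite expr1n mulr1 in cv; apply: (cvgr_to_le cv); near=> x; apply: cM.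
by apply/andP; split; near: x; [exact: nbhs_left_gt|exact: nbhs_left_lt].
Unshelve. all: by end_near. Qed.

Lemma sup_radial_length_ge0 f : (0 <= sup_radial_length f)%E.
Proof.
apply: le_trans (radial_length_ge0 f 0 0) _; apply: radial_length_le_sup.
  by rewrite lexx ltr01.
by rewrite lexx/= mulr_ge0// pi_ge0.
Qed.

Lemma coef_bound (K K' : R) f a b n : 1 <= K -> 0 <= K' ->
  harmonic_quasiconformal_in_disc K K' f -> harmonic_expansion f a b ->
  (sup_radial_length f < +oo)%E -> (1 <= n)%N ->
  ((cabs (a n) + cabs (b n))%:E
     <= (Num.sqrt K')%:E + K%:E * sup_radial_length f)%E.
Proof.
move=> K1 K'0 [[_ _ _ _ qc] [[fC1 _ _] _]] fab supfin; case: n => // m _.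
have pf : forall z, unit_disc z -> has_partials f z by case: fC1.
have [L LE] : exists L, sup_radial_length f = L%:E.
  by exists (fine (sup_radial_length f)); rewrite fineK// ge0_fin_numE// sup_radial_length_ge0.
rewrite LE -EFinM -EFinD lee_fin.
apply: (@le_of_le_mul_expn _ _ m.+1) => rho /andP[rho0 rho1].
apply/ler_addgt0Pr => e e0.
(* The approximation holds on open discs, the integration runs over [0, rho]: use a
   disc of radius strictly between rho and 1. *)
have sg01 : 0 < (1 + rho) / 2 < 1 by lra.
have [N mN hN] := coef_average_le_speed m K1 K'0 pf qc fab sg01 e0.
rewrite addrAC.
apply: (@integrate_radial_average _ f N) => //.
- exact: leq_ltn_trans mN.
- by rewrite rho0.
- by rewrite addr_ge0 ?cabs_ge0.
- by rewrite addr_ge0 ?sqrtr_ge0// ltW.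
- exact: le_trans K1.
- by move=> r /andP[r0 rr]; apply: hN; rewrite r0 /=; lra.
Qed.

End CoefficientBound.

(** * Affine maps *)

Section Dilation.
Context {R : realType}.
Local Notation C := (R[i]^o).
Implicit Types (z w k m : C) (L r t : R).

(** The class of affine maps is stable under partial differentiation, which makes
    second order regularity of the dilations as cheap as first order. *)
Definition affine k m : C -> C := fun z => k * z + m.

Lemma is_derive_real_affine (p q x : R) :
  is_derive x 1 (fun t : R => p * t + q) p.
Proof.
have -> : (fun t : R => p * t + q) = p \*: (id : R -> R) + cst q by [].
apply: is_derive_eq.
by rewrite addr0 /GRing.scale /= mulr1.
Qed.

Lemma affine_horizontal k m (y : R) :
  (fun t : R => complex.Re (affine k m (t +i* y))) =
    (fun t => complex.Re k * t + (complex.Re m - complex.Im k * y)) /\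
  (fun t : R => complex.Im (affine k m (t +i* y))) =
    (fun t => complex.Im k * t + (complex.Im m + complex.Re k * y)).
Proof.
by case: k m => k1 k2 [m1 m2]; split; apply/funext => t;
  rewrite /affine /=; ring.
Qed.

Lemma affine_vertical k m (x : R) :
  (fun t : R => complex.Re (affine k m (x +i* t))) =
    (fun t => - complex.Im k * t + (complex.Re m + complex.Re k * x)) /\
  (fun t : R => complex.Im (affine k m (x +i* t))) =
    (fun t => complex.Re k * t + (complex.Im m + complex.Im k * x)).
Proof.
by case: k m => k1 k2 [m1 m2]; split; apply/funext => t;
  rewrite /affine /=; ring.
Qed.

Lemma derive1_real_affine (p q x : R) : derive1 (fun t : R => p * t + q) x = p.
Proof. by rewrite derive1E; have /@derive_val := is_derive_real_affine p q x. Qed.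

Lemma derivable_real_affine (p q x : R) : derivable (fun t : R => p * t + q) x 1.
Proof. by have [] := is_derive_real_affine p q x. Qed.

Lemma partial_x_affine k m : partial_x (affine k m) = affine 0 k.
Proof.
apply/funext => z; rewrite /partial_x.
have [-> ->] := affine_horizontal k m (complex.Im z).
by rewrite !derive1_real_affine complex_eta /affine mul0r add0r.
Qed.

Lemma partial_y_affine k m : partial_y (affine k m) = affine 0 ('i * k).
Proof.
apply/funext => z; rewrite /partial_y.
have [-> ->] := affine_vertical k m (complex.Re z).
rewrite !derive1_real_affine /affine mul0r add0r; case: k => x y.
by apply/eqP; rewrite eq_complex /=; apply/andP; split; apply/eqP; ring.
Qed.

Lemma has_partials_affine k m z : has_partials (affine k m) z.
Proof.
rewrite /has_partials.
have [-> ->] := affine_horizontal k m (complex.Im z).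
have [-> ->] := affine_vertical k m (complex.Re z).
by split; exact: derivable_real_affine.
Qed.

Lemma affine_dist k m z w : cabs (affine k m z - affine k m w) = cabs k * cabs (z - w).
Proof. by rewrite /affine opprD addrACA subrr addr0 -mulrBr cabsM. Qed.

Lemma affine_continuous k m : continuous (affine k m).
Proof.
move=> z; have FF : Filter (nbhs z) by exact: nbhs_filter.
apply/cvg_cabsP => e e0.
have k1 : 0 < cabs k + 1 by rewrite ltr_wpDl// cabs_ge0.
have ek : 0 < e / (cabs k + 1) by rewrite divr_gt0.
apply: filterS (near_cabs z ek) => w; rewrite affine_dist ltr_pdivlMr// mulrC.
by apply: le_lt_trans; rewrite ler_wpM2r ?cabs_ge0// lerDl.
Qed.

Lemma class_C1_affine W k m : class_C1 W (affine k m).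
Proof.
split; first by move=> z _; exact: has_partials_affine.
  by move=> z _; rewrite partial_x_affine; exact: affine_continuous.
by move=> z _; rewrite partial_y_affine; exact: affine_continuous.
Qed.

Lemma harmonic_affine W k m : harmonic_on W (affine k m).
Proof.
split.
  split; first exact: class_C1_affine.
    by rewrite partial_x_affine; exact: class_C1_affine.
  by rewrite partial_y_affine; exact: class_C1_affine.
move=> z _; rewrite /laplacian partial_x_affine partial_y_affine.
by rewrite partial_x_affine partial_y_affine /affine mulr0 !mul0r !addr0.
Qed.

Lemma d_z_affine k m z : d_z (affine k m) z = k /\ d_zbar (affine k m) z = 0.
Proof.
rewrite /d_z /d_zbar partial_x_affine partial_y_affine /affine !mul0r !add0r.
have ii (j : C) : j * j = -1 -> (k - j * (j * k)) / 2 = k /\ (k + j * (j * k)) / 2 = 0.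
  move=> jj; rewrite !mulrA jj !mulN1r opprK subrr mul0r; split=> //.
  by rewrite -{1 2}[k]mulr1 -mulrDr mulfK// pnatr_eq0.
exact: ii (sqr_i R).
Qed.

Lemma disc_domain r : 0 < r -> domain [set z : C | cabs z < r].
Proof.
move=> r0; split.
- rewrite (_ : [set z | _] = @cabs R @^-1` [set x | x < r])//.
  apply: open_comp; last exact: open_lt.
  by move=> z _; exact: cabs_continuous.
- have -> : [set z : C | cabs z < r] =
      \bigcup_(z in [set z : C | cabs z < r]) [set t%:C * z | t in `[0, 1]%classic].
    apply/seteqP; split=> z /=.
      by move=> zr; exists z => //=; exists 1; rewrite ?mul1r//= in_itv /= ler01 lexx.
    move=> [w /= wr [t]]; rewrite /= in_itv /= => /andP[t0 t1] <-.
    rewrite cabsM cabs_real ger0_norm//; apply: le_lt_trans wr.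
    by rewrite ler_piMl// cabs_ge0.
  (* All the segments [0, z] of the union contain 0. *)
  apply: bigcup_connected.
    by exists 0 => z _ /=; exists 0; rewrite ?mul0r//= in_itv /= lexx ler01.
  move=> z _; apply: connected_continuous_connected.
    exact: segment_connected.
  apply: continuous_subspaceT => t; apply: cvg_mulC; last exact: cvg_cst.
  exact: real_complex_continuous.
- by exists 0; rewrite /= cabs0.
Qed.

Lemma affine_ACL W k m : ACL W (affine k m).
Proof.
have ac (s d : R) (p : R -> C) : (forall x y, cabs (p x - p y) = `|x - y|) ->
    abs_continuous s d (affine k m \o p).
  move=> isop e e0.
  have k1 : 0 < cabs k + 1 by rewrite ltr_wpDl// cabs_ge0.
  exists (e / (cabs k + 1)); first by rewrite divr_gt0.
  move=> n u v uv _; rewrite ltr_pdivlMr// mulrC; apply: le_lt_trans.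
  rewrite mulr_sumr; apply: ler_sum => j _ /=; have [_ [uvj _]] := uv j.
  rewrite affine_dist isop ger0_norm ?subr_ge0//.
  by rewrite ler_wpM2r ?subr_ge0// lerDl.
move=> a b c d _; split; apply: aeW => /= y _; apply: ac => s t.
  have -> : (s +i* y) - (t +i* y) = (s - t)%:C :> C.
    by apply/eqP; rewrite eq_complex /= subrr !eqxx.
  by rewrite cabs_real.
have -> : (y +i* s) - (y +i* t) = 'i * (s - t)%:C :> C.
  by apply/eqP; rewrite eq_complex /=; apply/andP; split; apply/eqP; ring.
by rewrite cabsM cabs_i mul1r cabs_real.
Qed.

End Dilation.

(** * The extremal mapping *)

Section ExtremalMapping.
Context {R : realType}.
Local Notation C := (R[i]^o).
Implicit Types (z w : C) (L r t : R).

Definition dilation L : C -> C := fun z => L%:C * z.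

Lemma dilation_affine L : dilation L = affine L%:C 0.
Proof. by apply/funext => z; rewrite /affine addr0. Qed.

Lemma dilation_inv L z : 0 < L -> dilation L^-1 (dilation L z) = z.
Proof.
move=> L0; rewrite /dilation mulrA -rmorphM /= mulVf ?gt_eqF// mul1r//.
Qed.

Lemma cabs_dilation L z : 0 < L -> cabs (dilation L z) = L * cabs z.
Proof. by move=> L0; rewrite cabsM cabs_real gtr0_norm. Qed.

Lemma dilation_image L : 0 < L ->
  dilation L @` unit_disc = [set z : C | cabs z < L].
Proof.
move=> L0; have Li0 : 0 < L^-1 by rewrite invr_gt0.
apply/seteqP; split=> z /=.
  by move=> [w wD <-]; rewrite cabs_dilation// gtr_pMr.
move=> zL; exists (dilation L^-1 z).
  by rewrite /unit_disc /= cabs_dilation// mulrC ltr_pdivrMr// mul1r.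
by rewrite -{1}[L]invrK dilation_inv.
Qed.

Lemma dilation_winds L w r : 0 < L -> 0 < r ->
  winds_once (fun t => dilation L (w + r%:C * cis t)) (dilation L w).
Proof.
move=> L0 r0; have Lr : 0 < L * r by rewrite mulr_gt0.
have cE t : dilation L (w + r%:C * cis t) - dilation L w = (L * r)%:C * cis t.
  by rewrite /dilation rmorphM; ring.
have cE' t : cabs (dilation L (w + r%:C * cis t) - dilation L w) = L * r.
  by rewrite cE cabs_polar// ltW.
split=> [t _|].
  by rewrite -subr_eq0; apply/eqP => /(congr1 cabs); rewrite cE' cabs0; lra.
(* The image of the circle is the circle of radius L r about L w, traversed with
   argument t. *)
exists id; split.
- by apply: continuous_subspaceT => t; exact: cvg_id.
- by move=> t _; rewrite cE' cE.
- by rewrite subr0.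
Qed.

Lemma dilation_harmonic_quasiconformal L : 0 < L ->
  harmonic_quasiconformal_in_disc 1 0 (dilation L).
Proof.
move=> L0; have Li0 : 0 < L^-1 by rewrite invr_gt0.
split; last by rewrite dilation_affine; exact: harmonic_affine.
split.
- split; first exact: disc_domain.
  by rewrite dilation_image//; exact: disc_domain.
- split.
  + split; [by move=> z zD; exists z| |exact: subset_refl].
    move=> z w _ _ zw; by rewrite -(dilation_inv z L0) zw dilation_inv.
  + by apply: continuous_subspaceT; rewrite dilation_affine; exact: affine_continuous.
  + exists (dilation L^-1); last by move=> z _; exact: dilation_inv.
    by apply: continuous_subspaceT; rewrite dilation_affine; exact: affine_continuous.
- by move=> w r r0 _; exact: dilation_winds.
- by rewrite dilation_affine; exact: affine_ACL.
- move=> z _; rewrite dilation_affine /norm_D /Defs.jacobian.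
  have [-> ->] := d_z_affine (L%:C : C) 0 z.
  by rewrite cabs0 expr0n subr0 addr0 mul1r addr0.
Qed.

Lemma dilation_radial_length L r t : 0 < L -> 0 <= r ->
  radial_length (dilation L) r t = (L * r)%:E.
Proof.
move=> L0 r0; rewrite /radial_length.
under eq_integral => x _.
  rewrite dilation_affine; have [-> ->] := d_z_affine (L%:C : C) 0 (x%:C * cis t).
  rewrite mulr0 addr0 cabs_real gtr0_norm//; over.
rewrite integral_cst//= lebesgue_measure_itv /= lte_fin.
move: r0; rewrite le_eqVlt => /predU1P[<-|r0]; first by rewrite ltxx mulr0 mule0.
by rewrite r0 sube0 EFinM.
Qed.

Lemma dilation_sup_radial_length L : 0 < L ->
  sup_radial_length (dilation L) = L%:E.
Proof.
move=> L0; have ub : (sup_radial_length (dilation L) <= L%:E)%E.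
  apply: ge_ereal_sup => _ [t _ <-]; apply: ge_ereal_sup => _ [r /andP[r0 r1] <-].
  by rewrite dilation_radial_length// lee_fin ler_piMr// ltW.
have fin : sup_radial_length (dilation L) \is a fin_num.
  by rewrite ge0_fin_numE ?sup_radial_length_ge0// (le_lt_trans ub)// ltry.
apply/eqP; rewrite eq_le ub /= -(fineK fin) lee_fin.
apply: (@le_of_le_mul_expn _ _ _ 1) => rho /andP[rho0 rho1].
rewrite expr1 -lee_fin (fineK fin) -(@dilation_radial_length L rho 0)//; last exact: ltW.
apply: radial_length_le_sup; first by rewrite ltW.
by rewrite lexx/= mulr_ge0// pi_ge0.
Qed.

Lemma dilation_expansion L :
  harmonic_expansion (dilation L) (fun n => if n == 1%N then L%:C else 0) (fun=> 0).
Proof.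
move=> z _; exists (dilation L z), 0; split; last by rewrite addr0.
  apply: cvg_near_cst; exists 2%N => // -[|[|N]] //= _; apply/eqP.
  rewrite big_nat_recl// big_nat_recl//= mul0r add0r expr1 big1 ?addr0//.
  by move=> k _; rewrite mul0r.
apply: cvg_near_cst; apply: nearW => N.
by apply/eqP; rewrite big1// => k _; rewrite rmorph0 mul0r.
Qed.

End ExtremalMapping.

Theorem theorem1p7 (R : realType) :
  (forall (K K' : R) (f : R[i]^o -> R[i]^o) (a b : nat -> R[i]^o),
     1 <= K -> 0 <= K' ->
     harmonic_quasiconformal_in_disc K K' f ->
     harmonic_expansion f a b ->
     (sup_radial_length f < +oo)%E ->
     forall n : nat, (1 <= n)%N ->
       ((cabs (a n) + cabs (b n))%:E
          <= (Num.sqrt K')%:E + K%:E * sup_radial_length f)%E)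
  /\
  (forall L : R, 0 < L ->
     let f := fun z : R[i]^o => L%:C * z in
     [/\ harmonic_quasiconformal_in_disc 1 0 f,
         sup_radial_length f = L%:E &
         exists a b : nat -> R[i]^o,
           harmonic_expansion f a b /\
           ((cabs (a 1%N) + cabs (b 1%N))%:E
              = (Num.sqrt 0)%:E + 1%:E * sup_radial_length f)%E]).
Proof.
split=> [K K' f a b K1 K'0 fqc fab supfin n n1|L L0 f]; first exact: coef_bound.
have supL : sup_radial_length f = L%:E by exact: dilation_sup_radial_length.
split=> //; first exact: dilation_harmonic_quasiconformal.
exists (fun n => if n == 1%N then L%:C else 0), (fun=> 0).
split; first exact: dilation_expansion.
by rewrite supL eqxx cabs_real gtr0_norm// cabs0 addr0 sqrtr0 add0e mul1e.
Qed.
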